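(* Let $\mathcal F$ be a nonempty finite family of nonempty subsets of a finite ground set $V$. If $\tau(\mathcal F)\ge2$, then $\nu^*(\mathcal F)>1$.
   Context: For a family $\mathcal F$ of nonempty subsets of a ground set $V$: - $\tau(\mathcal F)=\min\{|X|:X\subseteq V,\ X\cap F\neq\emptyset\text{ for every }F\in\mathcal F\}$ is the transversal number; - $\nu^*(\mathcal F)=\max\{\sum_{F\in\mathcal F}y_F: y_F\in\mathbb R_{\ge0},\ \sum_{F\ni v}y_F\le1\text{ for every }v\in V\}$ is the fractional packing number. All hypergraphs (set families and their ground sets) are finite. *)

(* Defs.v *)
From HB Require Import structures.
From mathcomp Require Import all_boot all_order all_algebra.
From mathcomp Require Import boolp classical_sets reals topology normedtype derive.

Set Implicit Arguments.
Unset Strict Implicit.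
Unset Printing Implicit Defensive.

Import Order.TTheory GRing.Theory Num.Theory.
Import numFieldNormedType.Exports.

Local Open Scope ring_scope.

Definition is_transversal (V : finType) (F : {set {set V}}) (X : {set V}) :=
  [forall S in F, X :&: S != finset.set0].

(* The default element [set: V] of the arg min is itself a transversal as soon
   as the members of F are nonempty; see tauP. *)
Definition tau (V : finType) (F : {set {set V}}) : nat :=
  #|[arg min_(X < [set: V]%SET | is_transversal F X) #|X|]%N|.

(* Weights are functions on all of {set V}, but only their values on F are
   constrained and counted. *)
Definition fractional_packing (R : realType) (V : finType) (F : {set {set V}})
    (y : {set V} -> R) : Prop :=
  (forall S : {set V}, S \in F -> 0 <= y S) /\
  (forall v : V, \sum_(S in F | v \in S) y S <= 1).

Definition packing_weight (R : realType) (V : finType) (F : {set {set V}})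
    (y : {set V} -> R) : R := \sum_(S in F) y S.

(* The supremum is a maximum whenever the members of F are nonempty; see
   nu_starP. *)
Definition nu_star (R : realType) (V : finType) (F : {set {set V}}) : R :=
  sup [set packing_weight F y | y in fractional_packing (R := R) F]%classic.

Lemma tauP (V : finType) (F : {set {set V}}) : finset.set0 \notin F ->
  (exists2 X : {set V}, is_transversal F X & #|X| = tau F) /\
  (forall X : {set V}, is_transversal F X -> (tau F <= #|X|)%N).
Proof.
move=> F0; have tT : is_transversal F [set: V]%SET.
  apply/forall_inP => S SF; rewrite finset.setTI.
  by apply: contraNneq F0 => <-.
rewrite /tau; case: arg_minnP => // X tX minX; split; first by exists X.
exact: minX.
Qed.

Lemma fractional_packing_le1 (R : realType) (V : finType) (F : {set {set V}})
    (y : {set V} -> R) (S : {set V}) : finset.set0 \notin F ->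
  fractional_packing F y -> S \in F -> y S <= 1.
Proof.
move=> F0 [y0 y1] SF; have /set0Pn[v vS] : S != finset.set0.
  by apply: contraNneq F0 => <-.
apply: le_trans (y1 v); rewrite (bigD1 S) ?SF //= lerDl.
by apply: sumr_ge0 => T /andP[/andP[TF _] _]; exact: y0.
Qed.

Lemma nu_starP (R : realType) (V : finType) (F : {set {set V}}) :
  finset.set0 \notin F ->
  (exists2 y : {set V} -> R,
     fractional_packing F y & packing_weight F y = nu_star R F) /\
  (forall y : {set V} -> R,
     fractional_packing F y -> packing_weight F y <= nu_star R F).
Proof.
move=> F0; pose n := #|{set V}|.
pose fn (w : 'rV[R]_n) (S : {set V}) : R := w ord0 (enum_rank S).
pose box := [set w : 'rV[R]_n | forall i, `[0, 1]%classic (w ord0 i)]%classic.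
pose A := [set w | box w /\ fractional_packing F (fn w)]%classic.
have fnc S : continuous (fn^~ S) by exact: coord_continuous.
have sumc (P : pred {set V}) : continuous (fun w => \sum_(S | P S) fn w S).
  by apply: continuous_big => [|S _]; [exact: add_continuous|exact: fnc].
have cA : compact A.
  apply: (@subclosed_compact _ A box); last by move=> w [].
    have -> : A = (box `&` (\bigcap_(S in [set` F]) [set w | 0%R <= fn w S]
        `&` \bigcap_v [set w | (\sum_(S in F | v \in S) fn w S <= 1)%R]))%classic.
      apply/seteqP; split=> w /=.
        by move=> [bw [w0 w1]]; split=> //; split=> [S|v _]; [exact: w0|exact: w1].
      move=> [bw [w0 w1]]; split=> //; split=> [S|v]; first exact: w0.
      exact: (w1 v I).
    apply: closedI.
      have -> : box = (\bigcap_i ((fun w : 'rV[R]_n => w ord0 i) @^-1`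
                                    `[0, 1]%classic))%classic.
        by apply/seteqP; split=> w bw i => [_|]; [exact: bw|exact: (bw i I)].
      apply: closed_bigI => i _; apply: preimage_closed => [w _|].
        exact: coord_continuous.
      exact: interval_closed.
    apply: closedI; apply: closed_bigI.
      move=> S _; apply: (preimage_closed _ (@closed_ge _ 0)) => w _; exact: fnc.
    move=> v _; apply: (preimage_closed _ (@closed_le _ 1)) => w _; exact: sumc.
  apply: (@rV_compact R n (fun=> `[0, 1]%classic)) => _.
  exact: segment_compact.
have rep y : fractional_packing F y ->
    exists2 w, A w & packing_weight F (fn w) = packing_weight F y.
  move=> py; pose z S := if S \in F then y S else 0.
  pose w : 'rV[R]_n := \row_i z (enum_val i).
  have wz S : fn w S = z S by rewrite /fn mxE enum_rankK.
  have zy S : S \in F -> fn w S = y S by rewrite wz /z => ->.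
  have [y0 y1] := py.
  exists w; last by apply: eq_bigr => S; exact: zy.
  split; last split=> [S SF|v]; last first.
  - rewrite (eq_bigr y) => [|S /andP[SF _]]; [exact: y1|exact: zy].
  - by rewrite zy ?y0.
  move=> i /=; rewrite mxE /z in_itv /=; case: ifP => iF.
    by rewrite y0 //= (fractional_packing_le1 F0 py iF).
  by rewrite lexx ler01.
have p0 : fractional_packing F (fun=> 0 : R).
  by split=> // v; rewrite big1 ?ler01.
have [w0 Aw0 _] := rep _ p0.
have [||c cA' maxc] := @compact_EVT_max _ R (fun w => packing_weight F (fn w)) A _ cA.
- by exists w0.
- by apply: continuous_subspaceT; exact: sumc.
move: cA'; rewrite inE => -[_ pc].
have ub y : fractional_packing F y ->
    packing_weight F y <= packing_weight F (fn c).
  by move=> /rep[w Aw <-]; apply: maxc; rewrite inE.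
have nuE : packing_weight F (fn c) = nu_star R F.
  apply/eqP; rewrite eq_le; apply/andP; split.
    apply: ub_le_sup; last by exists (fn c).
    by exists (packing_weight F (fn c)) => _ [y py <-]; exact: ub.
  apply: ge_sup; first by exists (packing_weight F (fn c)), (fn c).
  by move=> _ [y py <-]; exact: ub.
by split=> [|y /ub]; [exists (fn c)|rewrite nuE].
Qed.

(* Main.v *)
Require Import Defs.
From mathcomp Require Import all_boot all_order all_algebra reals.
Import Order.TTheory GRing.Theory Num.Theory.
Local Open Scope ring_scope.

(** Since the transversal number exceeds one, every vertex misses at least one
    member of the family. With [k] members, a vertex thus lies in at most
    [k - 1] of them, so the uniform weight [1 / (k - 1)] is a fractional
    packing; its total weight is [k / (k - 1) > 1]. The division makes sense
    because a vertex of one member misses another one, whence [k >= 2]. *)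

(** Otherwise the singleton of [v] would be a transversal. *)
Lemma tau_gt1_missed (V : finType) (F : {set {set V}}) (v : V) :
  finset.set0 \notin F -> (2 <= tau F)%N ->
  exists2 S : {set V}, S \in F & v \notin S.
Proof.
move=> F0 tau2; have [_ tau_min] := tauP F0.
have : ~~ Defs.is_transversal F [set v].
  by apply: contraL tau2 => /tau_min; rewrite cards1 -ltnNge ltnS.
case/forall_inPn=> S SF; rewrite negbK setI_eq0 disjoints1 => vS.
by exists S.
Qed.

Lemma uniform_fractional_packing (R : realType) (V : finType)
    (F : {set {set V}}) (d : nat) : (0 < d)%N ->
  (forall v : V, #|[set S in F | v \in S]| <= d)%N ->
  @fractional_packing R V F (fun=> d%:R^-1).
Proof.
move=> d_gt0 deg; split=> [S _|v]; first by rewrite invr_ge0 ler0n.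
rewrite sumr_const -[leLHS]mulr_natl ler_pdivrMr ?ltr0n // mul1r ler_nat.
by have := deg v; rewrite cardsE.
Qed.

Theorem proposition4p4 (R : realType) (V : finType) (F : {set {set V}})
    (F_nonempty : F != finset.set0) (F_members : finset.set0 \notin F)
    (tauF : (2 <= tau F)%N) :
  1 < nu_star R F.
Proof.
have missed v := tau_gt1_missed V F v F_members tauF.
have deg v : (#|[set S in F | v \in S]| < #|F|)%N.
  have [S SF vS] := missed v; apply/proper_card/properP; split.
    by apply/subsetP=> T; rewrite inE => /andP[].
  by exists S; rewrite // inE SF.
have k_gt1 : (1 < #|F|)%N.
  have [S SF] := set0Pn _ F_nonempty.
  have /set0Pn[v vS] : S != finset.set0.
    by apply: contraNneq F_members => <-.
  apply: leq_ltn_trans (deg v).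
  by apply/card_gt0P; exists S; rewrite inE SF.
case kE : #|F| k_gt1 => [|d] // d_gt0.
have packing : @fractional_packing R V F (fun=> d%:R^-1).
  by apply: uniform_fractional_packing => // v; rewrite -ltnS -kE.
have [_ nu_max] := nu_starP R F_members.
apply: lt_le_trans (nu_max _ packing).
rewrite /packing_weight sumr_const kE -[ltRHS]mulr_natl.
by rewrite ltr_pdivlMr ?ltr0n // mul1r ltr_nat.
Qed.
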